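(* Let $A, B \in M_n(\mathbb{C})$ be such that the pair $(A,B)$ has property L. Assume that $B$ is diagonalizable and that $A + z_0 B$ is diagonalizable for every exceptional point $z_0$ of the matrix pencil $z \mapsto A + zB$. Then $AB = BA$.
   Context: A pair $(A,B) \in M_n(\mathbb{C})^2$ has property L if there exist $n$ linear forms $f_1,\dots,f_n$ on $\mathbb{C}^2$ such that for all $(x,y) \in \mathbb{C}^2$, the characteristic polynomial of $xA+yB$ equals $\prod_{k=1}^n (X - f_k(x,y))$. The generic number $p$ of eigenvalues of the pencil $z \mapsto A+zB$ is the number of distinct eigenvalues of the matrix $A + tB$, viewed over the field of fractions of the ring of entire functions in the variable $t$ (with $t$ the identity function), in an algebraic closure of that field. A complex number $z$ is regular if $A+zB$ has exactly $p$ distinct eigenvalues, and exceptional otherwise. *)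

(* Defs.v *)
From HB Require Import structures.
From mathcomp Require Import all_boot all_order all_algebra.
Set Implicit Arguments. Unset Strict Implicit. Unset Printing Implicit Defensive.
Import Order.TTheory GRing.Theory Num.Theory.
Local Open Scope ring_scope.

Definition propertyL (R : numClosedFieldType) (n : nat) (A B : 'M[R]_n) : Prop :=
  exists f : 'I_n -> R * R,
    forall x y : R,
      char_poly (x *: A + y *: B) = \prod_(k < n) ('X - ((f k).1 * x + (f k).2 * y)%:P).

(* Number of distinct roots of a polynomial over a characteristic-0 field,
   counted in an algebraic closure: degree of the squarefree part P / gcd(P, P'). *)
Definition n_distinct_roots (F : fieldType) (P : {poly F}) : nat :=
  ((size P).-1 - (size (gcdp P P^`())).-1)%N.

Definition pencil_generic (R : numClosedFieldType) (n : nat) (A B : 'M[R]_n)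
  : 'M[{fraction {poly R}}]_n :=
  map_mx (fun a : R => tofrac (a%:P)) A + tofrac ('X : {poly R}) *: map_mx (fun a : R => tofrac (a%:P)) B.

Definition generic_num_eig (R : numClosedFieldType) (n : nat) (A B : 'M[R]_n) : nat :=
  n_distinct_roots (char_poly (pencil_generic A B)).

Definition has_num_eig (R : numClosedFieldType) (n : nat) (M : 'M[R]_n) (k : nat) : Prop :=
  exists s : seq R, [/\ uniq s, (forall x, eigenvalue M x = (x \in s)) & size s = k].

Definition regular_point (R : numClosedFieldType) (n : nat) (A B : 'M[R]_n) (z : R) : Prop :=
  has_num_eig (A + z *: B) (generic_num_eig A B).

Definition exceptional_point (R : numClosedFieldType) (n : nat) (A B : 'M[R]_n) (z : R) : Prop :=
  ~ regular_point A B z.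

(* Main.v *)
Require Import Defs.
From HB Require Import structures.
From mathcomp Require Import all_boot all_order all_algebra.
From mathcomp Require Import ring.
(** Let [l_i(t) = a_i + b_i t] be the distinct linear forms given by property L,
    and let [M = A + tB], a matrix over [R[t]].  The generalized eigenmodules
    [K_i = ker (M - l_i)^(e_i)] in [R[t]^n] sum to a submodule of full rank.  They
    are independent modulo [t - z] for every [z]: if [z] is regular the values
    [l_i(z)] are distinct, and if [A + zB] is diagonalizable, the operators
    [(M - l_i) / (t - z)] separate the forms that coincide at [z], since these have
    distinct slopes.  Hence [R[t]^n] is the direct sum of the [K_i].  The same
    argument at infinity, that is at the point [0] of the pencil [B + tA], uses
    that [B] is diagonalizable and shows that a constant vector has constant
    components.  A constant vector [x] of [K_i] satisfies [Bx = b_i x], and [Ax]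
    is again a constant vector of [K_i], so [BAx = b_i Ax = ABx]. *)

Set Implicit Arguments. Unset Strict Implicit. Unset Printing Implicit Defensive.
Import Order.TTheory GRing.Theory Num.Theory.
Local Open Scope ring_scope.

(** * The action of [R[X]] on column vectors through a matrix *)

Section HornerAction.

Variables (R : comNzRingType) (n m : nat).
Implicit Types (M : 'M[R]_n.+1) (p q : {poly R}) (v : 'M[R]_(n.+1, m)).

Definition hact M p v : 'M[R]_(n.+1, m) := horner_mx M p *m v.

Lemma hactM M p q v : hact M (p * q) v = hact M p (hact M q v).
Proof. by rewrite /hact rmorphM /= mulmxA. Qed.

Lemma hactC M p q v : hact M p (hact M q v) = hact M q (hact M p v).
Proof. by rewrite -!hactM mulrC. Qed.

Lemma hactBl M p q v : hact M (p - q) v = hact M p v - hact M q v.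
Proof. by rewrite /hact rmorphB mulmxBl. Qed.

Lemma hactDl M p q v : hact M (p + q) v = hact M p v + hact M q v.
Proof. by rewrite /hact rmorphD mulmxDl. Qed.

Lemma hact_polyC M a v : hact M a%:P v = a *: v.
Proof. by rewrite /hact horner_mx_C mul_scalar_mx. Qed.

Lemma hact1 M v : hact M 1 v = v.
Proof. by rewrite /hact rmorph1 mul1mx. Qed.

Lemma hact_XsubC M a v : hact M ('X - a%:P) v = (M - a%:M) *m v.
Proof. by rewrite /hact rmorphB /= horner_mx_X horner_mx_C. Qed.

Lemma hactZ M p a v : hact M p (a *: v) = a *: hact M p v.
Proof. by rewrite /hact -scalemxAr. Qed.

Lemma hactB M p u v : hact M p (u - v) = hact M p u - hact M p v.
Proof. by rewrite /hact mulmxBr. Qed.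

Lemma hact_sum M p (I : finType) (v : I -> 'M[R]_(n.+1, m)) :
  hact M p (\sum_i v i) = \sum_i hact M p (v i).
Proof. by rewrite /hact mulmx_sumr. Qed.

Lemma hact0 M p : hact M p 0 = 0.
Proof. by rewrite /hact mulmx0. Qed.

Lemma hact_XsubC_diff M a b v :
  hact M ('X - b%:P) v - hact M ('X - a%:P) v = (a - b) *: v.
Proof.
by rewrite -hactBl opprB addrC addrA subrK -polyCB hact_polyC.
Qed.

Lemma hact_prod_eq0 M (I : finType) (p : I -> {poly R}) i v :
  hact M (p i) v = 0 -> hact M (\prod_k p k) v = 0.
Proof. by move=> vi; rewrite (bigD1 i) //= mulrC hactM vi hact0. Qed.

(** For [c] true, [M - a] is one of the [e] factors [M - b]; truncation at [e = 0] is harmless,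
    since then [v = 0]. For [c] false it commutes past them. *)
Lemma hact_XsubC_pred M a b (e : nat) (c : bool) v : (c -> a = b) ->
  hact M (('X - b%:P) ^+ e) v = 0 ->
  hact M (('X - b%:P) ^+ (e - c)) (hact M ('X - a%:P) v) = 0.
Proof.
case: c => [/(_ isT) ->|_]; last by rewrite subn0 hactC => ->; rewrite hact0.
case: e => [|e]; first by rewrite expr0 hact1 => ->; rewrite !hact0.
by rewrite subn1 /= -hactM -exprSr.
Qed.

End HornerAction.

(** Makes [\sum_k e k] the measure of the two inductions on families of exponents. *)
Lemma sum_dec_lt (I : finType) (e : I -> nat) i :
  (0 < e i)%N -> (\sum_k (e k - (k == i)) < \sum_k e k)%N.
Proof.
move=> ei; rewrite [X in (X < _)%N](bigD1 i) //= [X in (_ < X)%N](bigD1 i) //=.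
rewrite eqxx subn1 -addSn prednK // leq_add2l.
by apply: leq_sum => k _; exact: leq_subr.
Qed.

Lemma hact_coprime_eq0 (F : fieldType) n m (T : 'M[F]_n.+1) p q
    (x : 'M[F]_(n.+1, m)) :
  coprimep p q -> hact T p x = 0 -> hact T q x = 0 -> x = 0.
Proof.
move=> /Bezout_eq1_coprimepP[u u1] px qx.
by rewrite -[x](hact1 T) -u1 hactDl !hactM px qx !hact0 addr0.
Qed.

(** A product over distinct roots kills [T]. Hence [(T - c) x] is killed both by [(T - c)^k] and by
    the product over the roots other than [c], and these polynomials are coprime. *)
Lemma diagonalizable_ker (F : fieldType) n m (T : 'M[F]_n.+1) c k
    (x : 'M[F]_(n.+1, m)) :
  diagonalizable T ->
  hact T (('X - c%:P) ^+ k) x = 0 -> hact T ('X - c%:P) x = 0.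
Proof.
move=> /diagonalizableP[rs rs_uniq /mxminpoly_minP rsT] xk.
pose p := \prod_(r <- rem c rs) ('X - r%:P).
apply: (@hact_coprime_eq0 _ _ _ T (('X - c%:P) ^+ k) p).
- rewrite coprimep_expl // coprimep_sym coprimep_XsubC root_prod_XsubC.
  by rewrite mem_rem_uniq // inE eqxx.
- by rewrite hactC xk hact0.
rewrite -hactM mulrC; have [crs|crs] := boolP (c \in rs).
  have -> : ('X - c%:P) * p = \prod_(r <- rs) ('X - r%:P).
    by rewrite (perm_big _ (perm_to_rem crs)) big_cons.
  by rewrite /hact rsT mul0mx.
by rewrite /p rem_id // hactM /hact rsT mul0mx mulmx0.
Qed.

(** * Pencils over [F[t]] and their evaluation at a point *)

Section Pencil.

Variables (F : fieldType) (n : nat).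
Implicit Types (A B : 'M[F]_n.+1) (a b : F * F) (z : F) (v w : 'cV[{poly F}]_n.+1).

Definition pencil A B : 'M[{poly F}]_n.+1 := map_mx polyC A + 'X *: map_mx polyC B.

(** The form [a.1 * x + a.2 * y] at [(x, y) = (1, t)], with ['X] for [t]. *)
Definition linform a : {poly F} := a.1%:P + a.2 *: 'X.

Definition evmx z m (v : 'M[{poly F}]_(n.+1, m)) : 'M[F]_(n.+1, m) :=
  map_mx (horner_eval z) v.

Lemma linformE a z : (linform a).[z] = a.1 + a.2 * z.
Proof. by rewrite !hornerE. Qed.

Lemma linformB a b z : (linform a).[z] = (linform b).[z] ->
  linform a - linform b = (a.2 - b.2) *: ('X - z%:P).
Proof.
rewrite !linformE => h; have -> : linform a = (b.1 + b.2 * z - a.2 * z)%:P + a.2 *: 'X.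
  by rewrite -h addrK.
by rewrite /linform -!mul_polyC; ring.
Qed.

Lemma evmx_pencil A B z : evmx z (pencil A B) = A + z *: B.
Proof. by apply/matrixP => i j; rewrite !mxE /horner_eval !hornerE. Qed.

Lemma evmx_hact A B z p v :
  evmx z (hact (pencil A B) p v) =
  hact (A + z *: B) (map_poly (horner_eval z) p) (evmx z v).
Proof. by rewrite /hact /evmx map_mxM map_horner_mx -evmx_pencil. Qed.

Lemma evmx_sum z (I : finType) (v : I -> 'cV[{poly F}]_n.+1) :
  evmx z (\sum_i v i) = \sum_i evmx z (v i).
Proof. by rewrite /evmx raddf_sum. Qed.

Lemma evmxZ z p v : evmx z (p *: v) = p.[z] *: evmx z v.
Proof. by rewrite /evmx map_mxZ. Qed.

Lemma evmxB z v w : evmx z (v - w) = evmx z v - evmx z w.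
Proof. by rewrite /evmx raddfB. Qed.

Lemma evmx0 z : evmx z (0 : 'cV_n.+1) = 0.
Proof. by rewrite /evmx raddf0. Qed.

Lemma map_evalXsubC z p : map_poly (horner_eval z) ('X - p%:P) = 'X - p.[z]%:P.
Proof. by rewrite rmorphB /= map_polyX map_polyC. Qed.

Lemma map_evalXsubCX z p k :
  map_poly (horner_eval z) (('X - p%:P) ^+ k) = ('X - p.[z]%:P) ^+ k.
Proof. by rewrite rmorphXn /= map_evalXsubC. Qed.

Lemma evmx_eq0P z v : evmx z v = 0 -> exists w, v = ('X - z%:P) *: w.
Proof.
move=> /matrixP v0; exists (map_mx (fun p => p %/ ('X - z%:P)) v).
apply/matrixP => i j; rewrite !mxE mulrC divpK // dvdp_XsubCl.
by have := v0 i j; rewrite !mxE /horner_eval => /eqP.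
Qed.

Lemma scalemx_inj (p : {poly F}) v w : p != 0 -> p *: v = p *: w -> v = w.
Proof.
move=> p0 /matrixP vw; apply/matrixP => i j.
by have := vw i j; rewrite !mxE => /(mulfI p0).
Qed.

Lemma scale_evmx_eq0 z p v : p.[z] != 0 -> evmx z (p *: v) = 0 -> evmx z v = 0.
Proof.
rewrite evmxZ => p0 /matrixP h; apply/matrixP => i j.
by have /eqP := h i j; rewrite !mxE mulf_eq0 (negPf p0) => /eqP.
Qed.

(** * Generalized eigenmodules of a family of distinct linear forms *)

Section Family.

Variables (A B : 'M[F]_n.+1) (I : finType) (f : I -> F * F).
Hypothesis f_inj : injective f.

Local Notation M := (pencil A B).
Local Notation L i := (linform (f i)).

(** Equal slopes would make the two forms equal, against the injectivity of [f]. *)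
Lemma linform_slope_neq z i j : i != j ->
  L i - L j = ((f i).2 - (f j).2) *: ('X - z%:P) -> (f i).2 - (f j).2 != 0.
Proof.
move=> nij Lij; apply: contra_neq nij => b0; apply: f_inj.
move: Lij; rewrite b0 scale0r => /eqP; rewrite subr_eq0.
move=> /eqP /(congr1 (horner_eval 0)).
rewrite /horner_eval !linformE !mulr0 !addr0 => a0; move/eqP: b0.
by rewrite subr_eq0 => /eqP; case: (f i) (f j) a0 => [? ?] [? ?] /= -> ->.
Qed.

(** Independence modulo ['X - z], by induction on the total exponent: applying [M - l_i] to every
    component lowers [e i]. *)
Lemma evmx_family_eq0 z :
  (forall i j, i != j -> (L i).[z] = (L j).[z] -> diagonalizable (A + z *: B)) ->
  forall (e : I -> nat) (v : I -> 'cV[{poly F}]_n.+1),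
    (forall i, hact M (('X - (L i)%:P) ^+ e i) (v i) = 0) ->
    evmx z (\sum_i v i) = 0 -> forall i, evmx z (v i) = 0.
Proof.
move=> Hd e v; have [N] := ubnP (\sum_k e k).
elim: N => // N IHN in e v *; rewrite ltnS => leN kv sum0 k0.
have IH i (w : I -> 'cV[{poly F}]_n.+1) : (0 < e i)%N ->
    (forall k, hact M (('X - (L k)%:P) ^+ (e k - (k == i))) (w k) = 0) ->
    evmx z (\sum_k w k) = 0 -> forall k, evmx z (w k) = 0.
  by move=> /sum_dec_lt lt_e; apply: IHN; apply: leq_trans leN.
have kdec i k :
  hact M (('X - (L k)%:P) ^+ (e k - (k == i))) (hact M ('X - (L i)%:P) (v k)) = 0.
  by apply: hact_XsubC_pred => // /eqP ->.
have v0 k : e k = 0%N -> v k = 0.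
  by move=> ek; have := kv k; rewrite ek expr0 hact1.
(* For [e i, e j > 0], [(l_i - l_j) v_k] is the difference of [(M - l_j) v_k] and
   [(M - l_i) v_k], which the induction hypothesis controls: directly when
   [l_i(z) <> l_j(z)], after division by ['X - z] otherwise. *)
case: (pickP [pred ij : I * I | [&& 0 < e ij.1, 0 < e ij.2 &
    (L ij.1).[z] != (L ij.2).[z]]%N]) => [[i j] /= /and3P[ei ej Lij]|same].
  have act0 l : (0 < e l)%N -> evmx z (hact M ('X - (L l)%:P) (v k0)) = 0.
    move=> el; apply: (IH l (fun k => hact M ('X - (L l)%:P) (v k))) => //.
    by rewrite -hact_sum evmx_hact sum0 hact0.
  apply: (@scale_evmx_eq0 z (L i - L j)).
    by rewrite hornerD hornerN subr_eq0.
  by rewrite -(hact_XsubC_diff M) evmxB !act0 // subrr.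
case: (pickP [pred ij : I * I | [&& 0 < e ij.1, 0 < e ij.2 & ij.1 != ij.2]%N])
    => [[i j] /= /and3P[ei ej nij]|one]; last first.
  (* If [e k0] is positive, all other exponents are 0, so the sum is [v k0] alone. *)
  have [ek|] := posnP (e k0); first by rewrite v0 // evmx0.
  move=> ek; move: sum0; rewrite (bigD1 k0) //= big1 ?addr0 // => l lk.
  apply: v0; have := one (l, k0); rewrite /= lk ek /= andbT.
  by rewrite lt0n => /negbFE/eqP.
have Lc l : (0 < e l)%N -> (L l).[z] = (L i).[z].
  by move=> el; have := same (l, i); rewrite /= el ei => /negbFE/eqP.
have Td : diagonalizable (A + z *: B) by apply: (Hd i j); rewrite // Lc.
(* All forms with positive exponent take the same value at [z], where diagonalizability turns
   generalized eigenvectors into eigenvectors. *)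
have evk l k : (0 < e l)%N -> exists w, hact M ('X - (L l)%:P) (v k) = ('X - z%:P) *: w.
  move=> el; apply: evmx_eq0P; have [ek|ek] := posnP (e k).
    by rewrite v0 // hact0 evmx0.
  rewrite evmx_hact map_evalXsubC (Lc l) // -(Lc k) //.
  apply: (diagonalizable_ker (k := e k)) => //.
  by rewrite -map_evalXsubCX -evmx_hact kv evmx0.
have X0 : 'X - z%:P != 0 :> {poly F} by rewrite polyXsubC_eq0.
have [w0 w0E] := evmx_eq0P sum0.
have w0_ker : hact M (\prod_k ('X - (L k)%:P) ^+ e k) w0 = 0.
  apply: (scalemx_inj X0); rewrite scaler0 -hactZ -w0E hact_sum big1 // => k _.
  exact: (hact_prod_eq0 (i := k)).
(* At [z] the annihilator of [w0] becomes a power of the single factor ['X - l_i(z)]. *)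
have w0_ev : hact (A + z *: B) ('X - (L i).[z]%:P) (evmx z w0) = 0.
  apply: (diagonalizable_ker (k := (\sum_k e k)%N)) => //.
  rewrite -[RHS](evmx0 z) -w0_ker evmx_hact; congr hact.
  rewrite rmorph_prod /= -prodrXr; apply: eq_bigr => k _.
  rewrite map_evalXsubCX; have [->|ek] := posnP (e k); first by rewrite !expr0.
  by rewrite Lc.
have act0 l : (0 < e l)%N ->
    exists2 w, hact M ('X - (L l)%:P) (v k0) = ('X - z%:P) *: w & evmx z w = 0.
  move=> el; have /fin_all_exists[w wE] := fun k => evk l k el.
  exists (w k0) => //; apply: (IH l) => // [k|].
    by apply: (scalemx_inj X0); rewrite scaler0 -hactZ -wE kdec.
  (* The quotients [w k] sum to [(M - l_l) w0], which vanishes at [z] by [w0_ev]. *)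
  suff -> : \sum_k w k = hact M ('X - (L l)%:P) w0.
    by rewrite evmx_hact map_evalXsubC Lc.
  apply: (scalemx_inj X0); rewrite -hactZ -w0E hact_sum scaler_sumr.
  by apply: eq_bigr => k _; rewrite wE.
have [wi wiE wi0] := act0 i ei; have [wj wjE wj0] := act0 j ej.
have Lij := linformB (esym (Lc j ej)).
have b0 := linform_slope_neq nij Lij.
apply: (@scale_evmx_eq0 z ((f i).2 - (f j).2)%:P); first by rewrite hornerC.
have -> : ((f i).2 - (f j).2)%:P *: v k0 = wj - wi.
  apply: (scalemx_inj X0); rewrite scalerA mulrC mul_polyC -Lij.
  by rewrite -(hact_XsubC_diff M) wiE wjE scalerBr.
by rewrite evmxB wi0 wj0 subrr.
Qed.

(** Induction on the total exponent decomposes [(M - l_i) v] and [(M - l_j) v], hence their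
    difference [(l_i - l_j) v] up to sign. It remains to divide each component by [l_i - l_j], which
    is a nonzero constant or has a single root. *)
Lemma pencil_decomposition :
  (forall z i j, i != j -> (L i).[z] = (L j).[z] -> diagonalizable (A + z *: B)) ->
  forall (e : I -> nat) (v : 'cV[{poly F}]_n.+1),
    hact M (\prod_k ('X - (L k)%:P) ^+ e k) v = 0 ->
    exists2 u : I -> 'cV[{poly F}]_n.+1,
      v = \sum_k u k & forall k, hact M (('X - (L k)%:P) ^+ e k) (u k) = 0.
Proof.
move=> Hd e v; have [N] := ubnP (\sum_k e k).
elim: N => // N IHN in e v *; rewrite ltnS => leN vP.
have IH i : (0 < e i)%N -> exists2 u : I -> 'cV[{poly F}]_n.+1,
    hact M ('X - (L i)%:P) v = \sum_k u k &
    forall k, hact M (('X - (L k)%:P) ^+ e k) (u k) = 0.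
  move=> ei; have lt_e := sum_dec_lt ei.
  have [|u vu uk] := IHN _ (hact M ('X - (L i)%:P) v) (leq_trans lt_e leN).
    rewrite -hactM -[RHS]vP; congr hact.
    rewrite (bigD1 i) //= [RHS](bigD1 i) //= mulrAC eqxx subn1 -exprSr prednK //.
    by congr (_ * _); apply: eq_bigr => k /negPf->; rewrite subn0.
  exists u => // k; rewrite -(subnK (leq_subr (k == i) (e k))) exprD hactM uk.
  by rewrite hact0.
case: (pickP [pred ij : I * I | [&& 0 < e ij.1, 0 < e ij.2 & ij.1 != ij.2]%N])
    => [[i j] /= /and3P[ei ej nij]|one]; last first.
  case: (pickP (fun i => 0 < e i)%N) => [i ei|none].
    have e0 k : k != i -> e k = 0%N.
      move=> ki; have := one (i, k); rewrite /= ei eq_sym ki andbT /=.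
      by rewrite lt0n => /negbFE/eqP.
    exists (fun k => if k == i then v else 0) => [|k].
      by rewrite (bigD1 i) //= eqxx big1 ?addr0 // => k /negPf->.
    case: eqP => [->|_]; last by rewrite hact0.
    move: vP; rewrite (bigD1 i) //= big1 ?mulr1 // => l /e0->.
    by rewrite expr0.
  exists (fun=> 0) => [|k]; last by rewrite hact0.
  move: vP; rewrite !big1 ?hact1 // => k _.
  by have := none k; rewrite lt0n => /negbFE/eqP->.
have [u vu uP] := IH i ei; have [w vw wP] := IH j ej.
have vL : (L i - L j) *: v = \sum_k (w k - u k).
  by rewrite -(hact_XsubC_diff M) vu vw sumrB.
have wuP k : hact M (('X - (L k)%:P) ^+ e k) (w k - u k) = 0.
  by rewrite hactB uP wP subrr.
have [b0|b0] := eqVneq ((f i).2 - (f j).2) 0.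
  have LE : L i - L j = ((f i).1 - (f j).1)%:P.
    by move/eqP: b0; rewrite subr_eq0 /linform => /eqP->; rewrite -!mul_polyC; ring.
  have a0 : (f i).1 - (f j).1 != 0.
    apply: contra_neq nij => a0; apply: f_inj; move/eqP: a0; move/eqP: b0.
    rewrite !subr_eq0 => /eqP + /eqP.
    by case: (f i) (f j) => [? ?] [? ?] /= -> ->.
  exists (fun k => (((f i).1 - (f j).1)^-1)%:P *: (w k - u k)) => [|k].
    rewrite -scaler_sumr -vL scalerA LE -polyCM mulVf //; exact/esym/scale1r.
  by rewrite hactZ wuP scaler0.
(* The root of [l_i - l_j]. The sum of the components vanishes there, so each one is divisible by
   ['X - z]. *)
pose z := - ((f i).1 - (f j).1) / ((f i).2 - (f j).2).
have Lz : (L i).[z] = (L j).[z].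
  by rewrite !linformE /z; field.
have LE := linformB Lz.
have X0 : 'X - z%:P != 0 :> {poly F} by rewrite polyXsubC_eq0.
have wu0 k : exists x, w k - u k = ('X - z%:P) *: x.
  apply: evmx_eq0P; apply: (evmx_family_eq0 _ wuP) => [i' j'|].
    exact: Hd.
  by rewrite -vL evmxZ hornerD hornerN Lz subrr scale0r.
have [x xE] := fin_all_exists wu0.
exists (fun k => (((f i).2 - (f j).2)^-1)%:P *: x k) => [|k].
  apply: (scalemx_inj X0); rewrite -scaler_sumr scalerA mulrC -scalerA.
  rewrite scaler_sumr -(eq_bigr _ (fun k _ => xE k)) -vL LE -mul_polyC.
  by rewrite scalerA mulrA -polyCM mulVf // mul1r.
apply: (scalemx_inj X0); rewrite scaler0 hactZ scalerA mulrC -scalerA -hactZ.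
by rewrite -xE wuP scaler0.
Qed.

End Family.

(** * Reversal of a pencil, its behaviour at infinity, and commutation *)

(* Coefficient reversal [t^d v(1/t)] of a vector of degree at most [d]. *)
Definition vrev d v := map_mx (fun p : {poly F} => \poly_(i < d.+1) p`_(d - i)) v.

Lemma coef_pencil_mul A B v i m :
  ((pencil A B *m v) i 0)`_m =
  \sum_k (A i k * (v k 0)`_m + B i k * (if m is m'.+1 then (v k 0)`_m' else 0)).
Proof.
rewrite mxE coef_sum; apply: eq_bigr => k _.
rewrite !mxE mulrDl coefD coefCM -mulrA coefXM coefCM.
by case: m => [|m] //=; rewrite mulr0.
Qed.

(** Subtracting a linear form leaves a pencil, so that reversal applies to each factor [M - l] in
    turn. *)
Lemma pencilB_linform A B a :
  pencil A B - (linform a)%:M = pencil (A - a.1%:M) (B - a.2%:M).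
Proof.
apply/matrixP => i j; rewrite !mxE /linform -!mul_polyC.
by case: (i == j); rewrite ?mulr0n ?mulr1n; ring.
Qed.

Lemma size_pencil_mul A B d v :
  (forall i, (size (v i 0%R) <= d.+1)%N) ->
  forall i, (size ((pencil A B *m v) i 0%R) <= d.+2)%N.
Proof.
move=> sv i; apply/leq_sizeP => m dm; rewrite coef_pencil_mul big1 // => k _.
case: m dm => // m dm; rewrite !(leq_sizeP _ _ (sv k)) ?mulr0 ?addr0 //.
exact: leq_trans dm.
Qed.

(** The coefficient [A v_m + B v_(m-1)] of [t^m] keeps its shape when [A] and [B] are exchanged and
    [m] becomes [d + 1 - m]; the degree bound gives [v_(d+1) = 0] at the boundary. *)
Lemma vrev_pencil_mul A B d v : (forall i, (size (v i 0%R) <= d.+1)%N) ->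
  vrev d.+1 (pencil A B *m v) = pencil B A *m vrev d v.
Proof.
move=> sv; apply/matrixP => i j; rewrite ord1 {j}; apply/polyP => m.
rewrite mxE coef_poly !coef_pencil_mul.
have [md|dm] := ltnP; last first.
  rewrite big1 // => k _; case: m dm => // m dm.
  rewrite !mxE !coef_poly ltnNge (leq_trans _ dm) //= ltnNge -ltnS dm /=.
  by rewrite !mulr0 addr0.
apply: eq_bigr => k _; rewrite !mxE addrC.
case: m md => [_|m md].
  by rewrite !subn0 coef_poly /= subn0 (leq_sizeP _ _ (sv k) d.+1) ?mulr0.
have {}md : (m < d.+1)%N by [].
rewrite subSS !coef_poly md; case: ltnP => [md'|dm].
  by rewrite -[(d - m)%N]subSS subSn.
have -> : m = d by apply/eqP; rewrite eqn_leq -ltnS md.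
by rewrite subnn.
Qed.

(** Each factor raises the degree bound by one, so [d] varies in the induction on [e]. Exchanging
    [A] and [B] exchanges the coefficients of the form. *)
Lemma vrev_hact A B a e d v : (forall i, (size (v i 0%R) <= d.+1)%N) ->
  hact (pencil A B) (('X - (linform a)%:P) ^+ e) v = 0 ->
  hact (pencil B A) (('X - (linform (a.2, a.1))%:P) ^+ e) (vrev d v) = 0.
Proof.
elim: e d v => [|e IHe] d v sv.
  rewrite !expr0 !hact1 => ->; apply/matrixP => i j; rewrite !mxE.
  by apply/polyP => m; rewrite coef_poly !coef0 if_same.
rewrite !exprSr !hactM !hact_XsubC !pencilB_linform /=.
move=> /(IHe d.+1) h; rewrite -vrev_pencil_mul //; apply: h.
exact: size_pencil_mul.
Qed.

Lemma pencil_commute A B (I : finType) (f : I -> F * F) (e : I -> nat) :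
  injective f ->
  (forall z i j, i != j -> (linform (f i)).[z] = (linform (f j)).[z] ->
    diagonalizable (A + z *: B)) ->
  diagonalizable B ->
  horner_mx (pencil A B) (\prod_k ('X - (linform (f k))%:P) ^+ e k) = 0 ->
  A *m B = B *m A.
Proof.
move=> f_inj Hd Bd ann.
pose g i := ((f i).2, (f i).1).
have g_inj : injective g.
  move=> i j [h2 h1]; apply: f_inj.
  by rewrite (surjective_pairing (f i)) h1 h2 -surjective_pairing.
have rev0 d (v : 'cV[{poly F}]_n.+1) : evmx 0 (vrev d v) = \col_i (v i 0)`_d.
  apply/matrixP => i j; rewrite ord1 !mxE /horner_eval horner_coef0 coef_poly.
  by rewrite subn0.
(* [evmx_family_eq0] at infinity, i.e. at the point 0 of the reversed pencil. *)
have lead0 d (v : I -> 'cV[{poly F}]_n.+1) :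
    (forall k, hact (pencil A B) (('X - (linform (f k))%:P) ^+ e k) (v k) = 0) ->
    (forall k i, (size (v k i 0%R) <= d.+1)%N) ->
    (forall i, ((\sum_k v k) i 0)`_d = 0) -> forall k i, (size (v k i 0%R) <= d)%N.
  move=> vk sv sum0 k i.
  have h : evmx 0 (vrev d (v k)) = 0.
    apply: (@evmx_family_eq0 B A I g g_inj 0 _ e (fun k => vrev d (v k))) => [*|l|].
    - by rewrite scale0r addr0.
    - exact: vrev_hact.
    rewrite evmx_sum; apply/matrixP => l j; rewrite ord1 summxE [RHS]mxE.
    rewrite -[RHS](sum0 l) summxE coef_sum; apply: eq_bigr => m _.
    by rewrite rev0 mxE.
  (* At size [d + 1] the vanishing coefficient would be the leading one. *)
  have := sv k i; rewrite leq_eqVlt => /predU1P[sd|//].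
  have: (v k i 0)`_d = 0 by move/matrixP/(_ i 0): h; rewrite rev0 !mxE.
  rewrite -[d in _`_d]/(d.+1.-1) -sd => /eqP; rewrite lead_coef_eq0 => /eqP->.
  by rewrite size_poly0.
suff comm (c : 'cV[F]_n.+1) : A *m B *m c = B *m A *m c.
  apply/trmx_inj/row_matrixP => i; rewrite -!tr_col; congr trmx.
  by rewrite !colE comm.
have [|u uE uk] := pencil_decomposition f_inj Hd (e := e) (v := map_mx polyC c).
  by rewrite /hact ann mul0mx.
(* The [u k] sum to the constant vector [c], so [lead0] lowers a common degree bound step by step
   down to 0. *)
have su d : (forall k i, (size (u k i 0%R) <= d.+1)%N) ->
    forall k i, (size (u k i 0%R) <= 1)%N.
  elim: d => // d IHd sd; apply: IHd; apply: lead0 => // i.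
  by rewrite -uE mxE coefC.
have {}su : forall k i, (size (u k i 0%R) <= 1)%N.
  apply: (su (\max_k \max_i size (u k i 0%R))%N) => k i.
  apply: leqW; apply: leq_trans (leq_bigmax k).
  exact: (leq_bigmax (F := fun i => size (u k i 0%R))).
(* A constant vector is its own reversal for [d = 0]; at 0 the reversed pencil is [B] and the
   reversed form is [b_k]. *)
have Beig k (x : 'cV[F]_n.+1) :
    hact (pencil A B) (('X - (linform (f k))%:P) ^+ e k) (map_mx polyC x) = 0 ->
    B *m x = (f k).2 *: x.
  move=> xk.
  have xx : evmx 0 (vrev 0 (map_mx polyC x)) = x.
    by rewrite rev0; apply/matrixP => i j; rewrite ord1 !mxE coefC.
  have sx i : (size (map_mx polyC x i 0%R : {poly F}) <= 1)%N.
    by rewrite mxE size_polyC leq_b1.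
  have := vrev_hact sx xk => /(congr1 (@evmx 0 1)).
  rewrite evmx0 evmx_hact xx scale0r addr0 map_evalXsubCX linformE mulr0 addr0 /=.
  move=> /(diagonalizable_ker Bd); rewrite hact_XsubC mulmxBl mul_scalar_mx.
  by move/eqP; rewrite subr_eq0 => /eqP.
pose x k := \col_i (u k i 0)`_0.
have ux k : u k = map_mx polyC (x k).
  by apply/matrixP => i j; rewrite ord1 !mxE; apply: size1_polyC.
have cE : c = \sum_k x k.
  apply/matrixP => i j; rewrite ord1 summxE.
  have /matrixP/(_ i 0) := uE; rewrite summxE mxE => /(congr1 (coefp 0)).
  by rewrite /= coefC /= => ->; rewrite coef_sum; apply: eq_bigr => k _; rewrite mxE.
have Bx k : B *m x k = (f k).2 *: x k by apply: Beig; rewrite -ux.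
rewrite cE !mulmx_sumr; apply: eq_bigr => k _.
rewrite -!mulmxA Bx -scalemxAr; apply/esym/Beig.
(* Since [B x = b_k x], one has [A x = (M - b_k t) x]. This is a polynomial in [M] applied to [x],
   so it stays in the same eigenmodule. *)
have -> : map_mx polyC (A *m x k) =
    hact (pencil A B) ('X - ((f k).2 *: 'X)%:P) (map_mx polyC (x k)).
  rewrite hact_XsubC mulmxBl mulmxDl mul_scalar_mx -map_mxM -scalemxAl -map_mxM Bx.
  by rewrite map_mxZ scalerA -mul_polyC mulrC addrK.
by rewrite hactC -ux uk hact0.
Qed.

End Pencil.

(** * Counting distinct roots, and the spectrum under property L *)

(** With [H = P / gcd(P, P')], the count is the degree of [H], and every root [a] of [P] is a root
    of [H]: otherwise the full power of ['X - a] in [P] would divide the gcd, hence [P'], which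
    characteristic 0 forbids. *)
Lemma leq_n_distinct_roots (F : fieldType) (r s : seq F) :
  (forall m, m.+1%:R != 0 :> F) -> uniq r -> {subset r <= s} ->
  (size r <= n_distinct_roots (\prod_(a <- s) ('X - a%:P)))%N.
Proof.
move=> char0 r_uniq rs; rewrite /n_distinct_roots; set P := \prod_(a <- s) _.
have P0 : P != 0 by rewrite monic_neq0 // monic_prod_XsubC.
set G := gcdp P P^`().
have /dvdpP[H PE] : G %| P by exact: dvdp_gcdl.
have G0 : G != 0 by apply: contra_neq P0 => G0; rewrite PE G0 mulr0.
have H0 : H != 0 by apply: contra_neq P0 => H0; rewrite PE H0 mul0r.
have -> : ((size P).-1 - (size G).-1)%N = (size H).-1.
  rewrite PE size_mul //; case: (size H) (size_poly_eq0 H) => [|h _].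
    by rewrite (negPf H0).
  by case: (size G) (size_poly_eq0 G) => [|k _]; rewrite ?(negPf G0) // addnS addnK.
rewrite -ltnS prednK ?size_poly_gt0 //.
apply: max_poly_roots => //; apply/allP => a /rs sa; apply: contraT => Ha.
have Pa : root P a by rewrite root_prod_XsubC.
have [[|m] [Q + PQ]] := multiplicity_XsubC P a; rewrite P0 /= => Qa.
  by rewrite PQ expr0 mulr1 (negPf Qa) in Pa.
have : ('X - a%:P) ^+ m.+1 %| P^`().
  apply: (@dvdp_trans _ G); last exact: dvdp_gcdr.
  rewrite -(@Gauss_dvdpr _ _ H) -?PE ?PQ ?dvdp_mull //.
  by rewrite coprimep_expl // coprimep_sym coprimep_XsubC.
(* The remaining term of [P'] is [(m + 1) Q ('X - a)^m], so divisibility would force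
   [(m + 1) Q(a) = 0]. *)
rewrite PQ derivM dvdp_addr; last exact: dvdp_mull.
rewrite deriv_exp derivXsubC mul1r /=.
rewrite mulrnAr -mulrnAl exprS dvdp_mul2r ?expf_neq0 ?polyXsubC_eq0 //.
rewrite dvdp_XsubCl /root hornerMn -mulr_natr mulf_eq0 (negPf (char0 m)) orbF.
by rewrite -/(root Q a) (negPf Qa).
Qed.

(** A nonzero difference of coefficients would have too many roots among the natural numbers, which
    are distinct in [R]. *)
Lemma polypoly_eval_inj (R : numDomainType) (u w : {poly {poly R}}) :
  (forall z, map_poly (horner_eval z) u = map_poly (horner_eval z) w) -> u = w.
Proof.
move=> uw; apply/polyP => i; apply/eqP; rewrite -subr_eq0; apply: contraT => d0.
pose s := [seq k%:R : R | k <- iota 0 (size (u`_i - w`_i))].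
have: (size s < size (u`_i - w`_i)%R)%N.
  apply: max_poly_roots => //; last first.
    by rewrite map_inj_uniq ?iota_uniq //; apply: mulrIn; rewrite oner_eq0.
  apply/allP => z _; rewrite /root hornerD hornerN subr_eq0.
  have /(congr1 (fun p : {poly R} => p`_i)) := uw z.
  by rewrite !coef_map /= /horner_eval => ->.
by rewrite size_map size_iota ltnn.
Qed.

(** Property L at [(1, z)] for every [z] gives the identity over [R[t]]. *)
Lemma propertyL_char_pencil (R : numClosedFieldType) n (A B : 'M[R]_n.+1)
    (f : 'I_n.+1 -> R * R) :
  (forall x y, char_poly (x *: A + y *: B) =
     \prod_(k < n.+1) ('X - ((f k).1 * x + (f k).2 * y)%:P)) ->
  char_poly (pencil A B) = \prod_k ('X - (linform (f k))%:P).
Proof.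
move=> fP; apply: polypoly_eval_inj => z.
rewrite map_char_poly /= -/(evmx z _) evmx_pencil -[A in LHS]scale1r fP.
rewrite rmorph_prod; apply: eq_bigr => k _ /=.
by rewrite map_evalXsubC linformE mulr1.
Qed.

Theorem mainTheorem6 (R : numClosedFieldType) (n : nat) (A B : 'M[R]_n) :
  propertyL A B ->
  diagonalizable B ->
  (forall z0 : R, exceptional_point A B z0 -> diagonalizable (A + z0 *: B)) ->
  A *m B = B *m A.
Proof.
case: n A B => [|n] A B; first by rewrite [A]flatmx0 [B]flatmx0.
move=> [f fP] Bd Hexc.
have chi := propertyL_char_pencil fP.
(* The forms of property L may repeat. [I] indexes the distinct ones, and multiplicities become
   exponents. *)
pose I := seq_sub (codom f).
have linform_inj : injective (@linform R).
  move=> a b /polyP ab; rewrite [a]surjective_pairing [b]surjective_pairing.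
  have := ab 0%N; have := ab 1%N; rewrite /linform !coefE /=.
  by rewrite !mulr0 !mulr1 !addr0 !add0r => -> ->.
apply: (@pencil_commute _ _ A B I val (fun x => #|[pred k | f k == val x]|)) => //.
- exact: val_inj.
(* If two distinct forms meet at [z], then [A + zB] has fewer eigenvalues than there are distinct
   forms, while the generic number is at least the number of forms. So [z] is not regular. *)
- move=> z i j nij Lij; apply: Hexc => -[s [s_uniq sE]].
  pose phi (x : I) := (linform (val x)).[z].
  have {}nij : ~~ uniq (codom phi).
    by apply: contra nij => /injectiveP/(_ _ _ Lij)->.
  have s_sub : {subset s <= undup (codom phi)}.
    move=> x; rewrite -sE eigenvalue_root_char mem_undup.
    rewrite -evmx_pencil -map_char_poly chi rmorph_prod.
    under eq_bigr do rewrite /= map_evalXsubC.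
    rewrite -(big_map (fun k => (linform (f k)).[z]) xpredT (fun a => 'X - a%:P)).
    rewrite root_prod_XsubC => /mapP[k _ ->].
    by apply/codomP; exists (SeqSub (codom_f f k)).
  move=> size_s; have := uniq_leq_size s_uniq s_sub; rewrite size_s leqNgt.
  move/negP; apply; move: nij; rewrite -ltn_size_undup => /leq_trans; apply.
  rewrite /generic_num_eig.
  have -> : pencil_generic A B = map_mx (@tofrac {poly R}) (pencil A B).
    by apply/matrixP => k l; rewrite !mxE rmorphD rmorphM.
  rewrite -map_char_poly chi rmorph_prod /=.
  under eq_bigr do rewrite rmorphB /= map_polyX map_polyC /=.
  pose psi (x : I) := tofrac (linform (val x)).
  have -> : size (codom phi) = size (codom psi) by rewrite !size_codom.
  rewrite -(big_map (fun k => tofrac (linform (f k))) xpredT (fun a => 'X - a%:P)).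
  apply: leq_n_distinct_roots.
  + move=> m; rewrite -(rmorph_nat (@tofrac {poly R})) tofrac_eq0.
    by rewrite -polyC_natr polyC_eq0 pnatr_eq0.
  + apply/injectiveP => x y /eqP; rewrite tofrac_eq => /eqP/linform_inj.
    exact: val_inj.
  + move=> _ /codomP[x ->]; have /codomP[k xk] := valP x.
    by apply/mapP; exists k; rewrite ?mem_index_enum // /psi xk.
(* The annihilating product is the characteristic polynomial with equal forms grouped together. *)
- rewrite -[RHS](Cayley_Hamilton (pencil A B)) chi; congr horner_mx.
  rewrite [RHS](partition_big (fun k => SeqSub (codom_f f k) : I) xpredT) //=.
  apply: eq_bigr => x _; rewrite -prodr_const; apply: eq_big => [k|k /eqP->//].
  by rewrite -val_eqE.
Qed.
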